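(* Let $\theta\in\mathbb{R}$ and let \[ E_\theta=\left\{\begin{pmatrix} z_1 & w\\ e^{i\theta}w & z_2\end{pmatrix} : z_1,z_2,w\in\mathbb{C}\right\}\subseteq M_2(\mathbb{C}). \] Then $\mathbb{F}=\mathbb{F}_{\mu_{E_\theta}}$.
   Context: $M_2(\mathbb{C})$ is the space of $2\times 2$ complex matrices and $\|A\|$ is the operator norm of $A$. The domain $\mathbb{F}$ is \[ \mathbb{F}=\{(a_{11},a_{22},\det(A),a_{12}+a_{21})\in\mathbb{C}^4 : A=(a_{ij})_{i,j=1}^2\in M_2(\mathbb{C}),\ \|A\|<1\}. \] For a linear subspace $E\subseteq M_2(\mathbb{C})$, the structured singular value of $A\in M_2(\mathbb{C})$ relative to $E$ is \[ \mu_E(A)=\left(\inf\{\|X\| : X\in E,\ \det(I-AX)=0\}\right)^{-1}, \] with $\mu_E(A)=0$ if there is no $X\in E$ with $\det(I-AX)=0$; and \[ \mathbb{F}_{\mu_E}=\{(a_{11},a_{22},\det(A),a_{12}+a_{21}) : A=(a_{ij})_{i,j=1}^2\in M_2(\mathbb{C}),\ \mu_E(A)<1\}. \] *)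

(* Defs.v *)
From HB Require Import structures.
From mathcomp Require Import all_boot all_order all_algebra.
From mathcomp Require Import all_classical all_reals all_analysis.
From mathcomp Require Import complex.

Set Implicit Arguments.
Unset Strict Implicit.
Unset Printing Implicit Defensive.

Import Order.TTheory GRing.Theory Num.Theory.

Local Open Scope classical_set_scope.
Local Open Scope ring_scope.
Local Open Scope complex_scope.

(* [`|x|] on matrices is the maximum norm of the entries, hence the
   explicit Euclidean norm. [normc z : R] is the modulus of z. *)
Definition l2norm (R : realType) (n : nat) (x : 'cV[R[i]]_n) : R :=
  Num.sqrt (\sum_(k < n) (ComplexField.Normc.normc (x k 0)) ^+ 2).

Definition opnorm (R : realType) (n : nat) (A : 'M[R[i]]_n) : R :=
  sup [set l2norm (A *m x) | x in [set x : 'cV[R[i]]_n | l2norm x <= 1]].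

Definition mx22 (R : realType) (a b c d : R[i]) : 'M[R[i]]_2 :=
  \matrix_(i < 2, j < 2)
    if i == 0 then (if j == 0 then a else b) else (if j == 0 then c else d).

(* The empty case is separate because the real-valued [inf] of the empty set
   is a junk value. When the set is nonempty its infimum is positive: if A X
   has eigenvalue 1 then 1 <= opnorm A * opnorm X. *)
Definition mu (R : realType) (E : set 'M[R[i]]_2) (A : 'M[R[i]]_2) : R :=
  let S := [set X | E X /\ \det (1%:M - A *m X) = 0] in
  if `[< S = set0 >] then 0 else (inf [set opnorm X | X in S])^-1.

Definition coords (R : realType) (A : 'M[R[i]]_2) :
    R[i] * R[i] * R[i] * R[i] :=
  (A 0 0, A 1 1, \det A, A 0 1 + A 1 0).

Definition domF (R : realType) : set (R[i] * R[i] * R[i] * R[i]) :=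
  [set coords A | A in [set A : 'M[R[i]]_2 | opnorm A < 1]].
Arguments domF R : clear implicits.

Definition domF_mu (R : realType) (E : set 'M[R[i]]_2) :
    set (R[i] * R[i] * R[i] * R[i]) :=
  [set coords A | A in [set A : 'M[R[i]]_2 | mu E A < 1]].

Definition expi (R : realType) (theta : R) : R[i] := cos theta +i* sin theta.

Definition E_theta (R : realType) (theta : R) : set 'M[R[i]]_2 :=
  [set X | exists z1 z2 w : R[i], X = mx22 z1 w (expi theta * w) z2].

Lemma E_theta_linear (R : realType) (theta : R) :
  E_theta theta 0 /\
  forall (c : R[i]) (X Y : 'M[R[i]]_2),
    E_theta theta X -> E_theta theta Y -> E_theta theta (c *: X + Y).
Proof.
split.
  exists 0, 0, 0; apply/matrixP => i j; rewrite !mxE mulr0.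
  by case: ifP => _; case: ifP.
move=> c _ _ [z1 [z2 [w ->]]] [z1' [z2' [w' ->]]].
exists (c * z1 + z1'), (c * z2 + z2'), (c * w + w').
apply/matrixP => i j; rewrite !mxE mulrDr mulrCA.
by case: ifP => _; case: ifP.
Qed.

(* Main.v *)
Require Import Defs.
From mathcomp Require Import all_boot all_order all_algebra.
From mathcomp Require Import all_classical all_reals all_analysis.
From mathcomp Require Import complex ring.

(** In fact [mu (E_theta theta) A = opnorm A] for every [A], so that the two
    domains come from the same set of matrices. The bound [<=] is the usual one:
    if [A X] has eigenvalue 1, then [1 <= |A| |X|]. For [>=], the space
    [E_theta] is [D S] with [D] unitary and [S] the complex symmetric matrices,
    and it contains a scalar multiple [X] of a unitary matrix sending any
    nonzero vector to any other one; taking [X (A x) = x] makes [I - A X]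
    singular with [|X| = |x| / |A x|]. *)

Set Implicit Arguments.
Unset Strict Implicit.
Unset Printing Implicit Defensive.

Import Order.TTheory GRing.Theory Num.Theory.

Local Open Scope classical_set_scope.
Local Open Scope complex_scope.
Local Open Scope ring_scope.

Section L2norm.
Variables (R : realType) (n : nat).
Implicit Types (x : 'cV[R[i]]_n) (A B : 'M[R[i]]_n).

Lemma normc_ge0 (z : R[i]) : 0 <= ComplexField.Normc.normc z.
Proof. by case: z => a b; exact: sqrtr_ge0. Qed.

Lemma l2norm_ge0 x : 0 <= l2norm x.
Proof. exact: sqrtr_ge0. Qed.

Lemma sqr_l2norm x :
  l2norm x ^+ 2 = \sum_(k < n) ComplexField.Normc.normc (x k 0) ^+ 2.
Proof. by rewrite sqr_sqrtr// sumr_ge0// => k _; exact: sqr_ge0. Qed.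

(** A polynomial form in the entries and their conjugates, so that [ring] can settle norm identities
    over [R[i]]. *)
Lemma sqr_l2normC x : (l2norm x ^+ 2)%:C = \sum_(k < n) x k 0 * (x k 0)^*.
Proof.
rewrite sqr_l2norm rmorph_sum; apply: eq_bigr => k _.
by rewrite -normCK rmorphXn.
Qed.

Lemma normc_le_l2norm x k : ComplexField.Normc.normc (x k 0) <= l2norm x.
Proof.
rewrite -(@ler_pXn2r _ 2) ?nnegrE ?normc_ge0 ?l2norm_ge0// sqr_l2norm.
by rewrite (bigD1 k)//= lerDl sumr_ge0// => j _; exact: sqr_ge0.
Qed.

Lemma l2normZ (c : R[i]) x :
  l2norm (c *: x) = ComplexField.Normc.normc c * l2norm x.
Proof.
apply/eqP; rewrite -(@eqrXn2 _ 2) ?mulr_ge0 ?normc_ge0 ?l2norm_ge0//.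
rewrite exprMn !sqr_l2norm mulr_sumr; apply/eqP/eq_bigr => k _.
by rewrite mxE ComplexField.Normc.normcM exprMn.
Qed.

Lemma l2norm_eq0 x : (l2norm x == 0) = (x == 0).
Proof.
apply/eqP/eqP => [x0|->]; last first.
  by rewrite -(scale0r 0) l2normZ ComplexField.Normc.normc0 mul0r.
apply/matrixP => k j; rewrite ord1 mxE.
apply: ComplexField.Normc.eq0_normc; apply: le_anti.
by rewrite normc_ge0 -x0 normc_le_l2norm.
Qed.

Lemma l2norm0 : l2norm (0 : 'cV[R[i]]_n) = 0.
Proof. by apply/eqP; rewrite l2norm_eq0. Qed.

(** Without a bound the [sup] in [opnorm] would be a default value. Entries of a unit-ball vector
    have modulus at most 1, so absolute row sums bound each coordinate. *)
Lemma opnorm_has_ubound A :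
  has_ubound [set l2norm (A *m x) | x in [set x : 'cV[R[i]]_n | l2norm x <= 1]].
Proof.
exists (Num.sqrt (\sum_(k < n)
  (\sum_(j < n) ComplexField.Normc.normc (A k j)) ^+ 2)) => _ [x /= x1 <-].
rewrite ler_wsqrtr// ler_sum// => k _.
rewrite lerXn2r ?nnegrE ?normc_ge0 ?sumr_ge0// => [j _|].
  exact: normc_ge0.
rewrite mxE; apply: (le_trans (y := \sum_(j < n)
  ComplexField.Normc.normc (A k j * x j 0))).
  elim/big_ind2 : _ => [|z s w t zs wt|//].
    by rewrite ComplexField.Normc.normc0.
  exact: le_trans (le_normcD _ _) (lerD zs wt).
apply: ler_sum => j _; rewrite ComplexField.Normc.normcM ler_piMr ?normc_ge0//.
exact: le_trans (normc_le_l2norm _ _) x1.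
Qed.

Lemma opnorm_ub A x : l2norm x <= 1 -> l2norm (A *m x) <= opnorm A.
Proof. by move=> x1; apply: (ub_le_sup (opnorm_has_ubound A)); exists x. Qed.

Lemma opnorm_ge0 A : 0 <= opnorm A.
Proof.
by apply: le_trans (@opnorm_ub A 0 _); rewrite ?l2norm_ge0 ?l2norm0 ?ler01.
Qed.

Lemma opnorm_le A (c : R) :
  (forall x, l2norm x <= 1 -> l2norm (A *m x) <= c) -> opnorm A <= c.
Proof.
move=> Ac; apply: ge_sup => [|_ [x /= x1 <-]]; last exact: Ac.
by exists (l2norm (A *m 0)), 0; rewrite //= l2norm0 ler01.
Qed.

Lemma l2norm_mulmx_le A x : l2norm (A *m x) <= opnorm A * l2norm x.
Proof.
have [->|x0] := eqVneq x 0; first by rewrite mulmx0 l2norm0 mulr0.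
have x_gt0 : 0 < l2norm x by rewrite lt_neqAle eq_sym l2norm_eq0 x0 l2norm_ge0.
have nV : ComplexField.Normc.normc (l2norm x)^-1%:C = (l2norm x)^-1.
  by rewrite /= expr0n addr0 sqrtr_sqr ger0_norm// invr_ge0 ltW.
rewrite -ler_pdivrMr// mulrC -nV -l2normZ scalemxAr opnorm_ub//.
by rewrite l2normZ nV mulVf// gt_eqF.
Qed.

Lemma det_sub_mulmx_eq0 A B :
  \det (1%:M - A *m B) = 0 -> 1 <= opnorm A * opnorm B.
Proof.
(* [det0P] yields a row vector in the left kernel; transposing first makes [v^T] a fixed vector of
   [A *m B]. *)
rewrite -det_tr => /eqP/det0P[v v0] /(congr1 trmx).
rewrite trmx_mul trmxK trmx0 mulmxBl mul1mx => /eqP.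
rewrite subr_eq0 -mulmxA => /eqP ABv.
have v_gt0 : 0 < l2norm v^T.
  rewrite lt_neqAle eq_sym l2norm_eq0 l2norm_ge0 andbT.
  by rewrite -(trmx0 _ _ _) (inj_eq trmx_inj).
rewrite -(ler_pM2r v_gt0) mul1r {1}ABv -mulrA.
apply: le_trans (l2norm_mulmx_le _ _) _.
by rewrite ler_wpM2l ?opnorm_ge0 ?l2norm_mulmx_le.
Qed.

End L2norm.

Lemma expi_conj (R : realType) (theta : R) : expi theta * (expi theta)^* = 1.
Proof.
rewrite -[_^*]/(conjc _) /expi; simpc; rewrite -!expr2 cos2Dsin2.
by rewrite [sin _ * _]mulrC addNr.
Qed.

Lemma exists_unimodular_ratio (R : realType) (c d : R[i]) :
  c * c^* = d * d^* -> exists l : R[i], l * l^* = 1 /\ c = l * d.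
Proof.
have [->|d0 cd] := eqVneq d 0.
  rewrite mul0r => /eqP; rewrite mulf_eq0 conjC_eq0 orbb => /eqP ->.
  by exists 1; rewrite conjC1 mulr0 mulr1.
exists (c / d); rewrite divfK//; split=> //.
rewrite rmorphM fmorphV mulrACA cd -invfM divff//.
by rewrite mulf_neq0 ?conjC_eq0.
Qed.

Lemma sum_ord2 (V : nmodType) (F : 'I_2 -> V) : \sum_(k < 2) F k = F 0 + F 1.
Proof.
by rewrite !big_ord_recl big_ord0 addr0; congr (_ + F _); apply/val_inj.
Qed.

(* With [u'] orthogonal to [u], [w] orthogonal to [v], [|u'| = |u|] and
   [|w| = |v|], the map [X y = (<y, u> v + l <y, u'> w) / |u|^2] sends [u] to
   [v] and is a multiple of a unitary one whenever [|l| = 1]. The relation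
   [X 1 0 = e^(i theta) X 0 1] is [c = l * d] for two numbers with [|c| = |d|],
   which provides [l]. *)
Lemma E_theta_transitive (R : realType) (theta : R) (u v : 'cV[R[i]]_2) :
  u != 0 -> exists2 X, E_theta theta X &
    X *m u = v /\ forall y, l2norm u * l2norm (X *m y) = l2norm v * l2norm y.
Proof.
move=> u0.
have := sqr_l2normC u; have := sqr_l2normC v; rewrite !sum_ord2.
set u1 := u 0 0; set u2 := u 1 0; set v1 := v 0 0; set v2 := v 1 0 => vN uN.
have [N NE NC] : exists2 N, N = u1 * u1^* + u2 * u2^* & N^* = N.
  exists (u1 * u1^* + u2 * u2^*) => //.
  by rewrite rmorphD !rmorphM/= !conjCK; ring.
have N0 : N != 0 by rewrite NE -uN fmorph_eq0 sqrf_eq0 l2norm_eq0.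
set e := expi theta; have ee : e * e^* = 1 := expi_conj theta.
(* The moduli agree because the left side is [- e] times the conjugate of the factor of [l]. *)
have [l [ll cd]] : exists l : R[i], l * l^* = 1 /\
    v2 * u1^* - e * (v1 * u2^*) = l * (v1^* * u2 - e * (v2^* * u1)).
  apply: exists_unimodular_ratio.
  rewrite !(rmorphB, rmorphM)/= !conjCK; ring: ee.
(* Here [u' = (- conj u2, conj u1)] and [w = (- conj v2, conj v1)]. Entry [1 0] is entered as [e]
   times entry [0 1], which makes membership immediate; [cd] then gives it the expected formula. *)
pose X := mx22 ((v1 * u1^* + l * (v2^* * u2)) / N)
  ((v1 * u2^* - l * (v2^* * u1)) / N) (e * ((v1 * u2^* - l * (v2^* * u1)) / N))
  ((v2 * u2^* + l * (v1^* * u1)) / N).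
have EX : E_theta theta X by do 3 eexists.
have X00 : X 0 0 = (v1 * u1^* + l * (v2^* * u2)) / N by rewrite mxE.
have X01 : X 0 1 = (v1 * u2^* - l * (v2^* * u1)) / N by rewrite mxE.
have X11 : X 1 1 = (v2 * u2^* + l * (v1^* * u1)) / N by rewrite mxE.
have X10 : X 1 0 = (v2 * u1^* - l * (v1^* * u2)) / N.
  rewrite mxE/= mulrA; congr (_ / N); apply/eqP; rewrite -subr_eq0; apply/eqP.
  move/eqP: cd; rewrite -subr_eq0 => /eqP cd; rewrite -oppr0 -cd; ring.
exists X => //; move: X EX X00 X01 X10 X11 => X _ X00 X01 X10 X11.
have XE (y : 'cV_2) k : (X *m y) k 0 = X k 0 * y 0 0 + X k 1 * y 1 0.
  by rewrite mxE sum_ord2.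
split.
  apply/matrixP => k j; rewrite ord1 XE.
  have [->|->] : k = 0 \/ k = 1.
    by case: k => [[|[|//]] ?]; [left|right]; apply/val_inj.
  - rewrite X00 X01 mulrAC [_ / N * _]mulrAC -mulrDl.
    by apply: (canLR (mulfK N0)); rewrite NE -/u1 -/u2 -/v1; ring.
  - rewrite X10 X11 mulrAC [_ / N * _]mulrAC -mulrDl.
    by apply: (canLR (mulfK N0)); rewrite NE -/u1 -/u2 -/v2; ring.
move=> y; apply/eqP.
rewrite -(@eqrXn2 _ 2) ?mulr_ge0 ?l2norm_ge0// !exprMn.
apply/eqP/(@complexI R); rewrite [LHS]rmorphM [RHS]rmorphM/= uN vN.
rewrite !sqr_l2normC !sum_ord2.
rewrite !XE X00 X01 X10 X11.
rewrite !(rmorphD, rmorphN, rmorphM, fmorphV)/= !conjCK NC -NE.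
(* Stated for free variables, so that [field] only has to deal with the denominator [N]. *)
have clear_N (a b c d a' b' c' d' p q p' q' : R[i]) :
    N * ((a / N * p + b / N * q) * (a' / N * p' + b' / N * q') +
         (c / N * p + d / N * q) * (c' / N * p' + d' / N * q')) =
    ((a * p + b * q) * (a' * p' + b' * q') +
     (c * p + d * q) * (c' * p' + d' * q')) / N by field.
rewrite clear_N; apply: (canLR (mulfK N0)); rewrite NE.
(* The cross terms vanish as [w] is orthogonal to [v], and the squared components of [y] along [u]
   and [u'] add up to [N] times its squared norm. *)
by ring: ll.
Qed.

Lemma mu_E_theta (R : realType) (theta : R) (A : 'M[R[i]]_2) :
  mu (E_theta theta) A = opnorm A.
Proof.
rewrite /mu; set S := [set X | _].
have S_Aneq0 x : A *m x != 0 -> exists2 X, S X &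
    l2norm (A *m x) * opnorm X <= l2norm x.
  move=> Ax0; have [X EX [XA Xn]] := E_theta_transitive theta x Ax0.
  have Ax_gt0 : 0 < l2norm (A *m x).
    by rewrite lt_neqAle eq_sym l2norm_eq0 Ax0 l2norm_ge0.
  exists X.
    split=> //; apply/eqP; rewrite -det_tr; apply/det0P; exists (A *m x)^T.
      by rewrite -(trmx0 _ _ _) (inj_eq trmx_inj).
    by rewrite -trmx_mul mulmxBl mul1mx -mulmxA XA subrr trmx0.
  rewrite mulrC -ler_pdivlMr//; apply: opnorm_le => y y1.
  by rewrite ler_pdivlMr// mulrC Xn ler_piMr ?l2norm_ge0.
(* Vectors killed by [A] provide no [X], but they satisfy any nonnegative bound. *)
have opnorm_le_nonker c : 0 <= c ->
    (forall x, l2norm x <= 1 -> A *m x != 0 -> l2norm (A *m x) <= c) ->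
    opnorm A <= c.
  move=> c0 Ac; apply: opnorm_le => x x1.
  by have [->|/Ac->//] := eqVneq (A *m x) 0; rewrite l2norm0.
(* If [S] is empty, no [x] has [A *m x != 0], so [opnorm A] is 0, the value assigned to [mu]. *)
case: asboolP => [S0|/eqP/set0P S0].
  apply/le_anti; rewrite opnorm_ge0/=; apply: opnorm_le_nonker => // x _ Ax0.
  by have [X] := S_Aneq0 x Ax0; rewrite S0.
have SA X : S X -> 0 < opnorm A /\ (opnorm A)^-1 <= opnorm X.
  move=> [_ /det_sub_mulmx_eq0 AX].
  have A_gt0 : 0 < opnorm A.
    rewrite lt_neqAle opnorm_ge0 andbT; apply: contraTneq AX => <-.
    by rewrite mul0r ler10.
  by rewrite -ler_pdivrMl// mulr1 in AX.
have A_gt0 : 0 < opnorm A by case: S0 => X /SA[].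
have infA : (opnorm A)^-1 <= inf [set opnorm X | X in S].
  apply: lb_le_inf => [|_ [X SX <-]]; last by have [] := SA X SX.
  by case: S0 => X SX; exists (opnorm X), X.
(* Strict positivity keeps the inverse away from the convention [0^-1 = 0] and lets it reverse
   inequalities. *)
have inf_gt0 : 0 < inf [set opnorm X | X in S].
  by apply: lt_le_trans infA; rewrite invr_gt0.
apply/le_anti/andP; split; first by rewrite invf_ple ?posrE.
apply: opnorm_le_nonker => [|x x1 /S_Aneq0[X SX AX]].
  by rewrite invr_ge0 ltW.
rewrite -div1r ler_pdivlMr//; apply: le_trans (le_trans AX x1).
rewrite ler_wpM2l ?l2norm_ge0//; apply: ge_inf; last by exists X.
by exists (opnorm A)^-1 => _ [Y SY <-]; have [] := SA Y SY.
Qed.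

Theorem corollary4p2 (R : realType) (theta : R) :
  domF R = domF_mu (E_theta theta).
Proof.
apply/seteqP; split => _ [A /= A1 <-]; exists A => //=.
  by rewrite mu_E_theta.
by rewrite -(mu_E_theta theta).
Qed.
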